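(* Let $f$ be a real function infinitely differentiable at $0$ whose Maclaurin series has radius of convergence $R>0$ (possibly $R=\infty$) and converges to $f$ on $(-R,R)$. Let $0<a_1<\cdots<a_n$, let $I=(-R/a_n,R/a_n)$, and define $f_r(x):=f(a_r x)$ for $x\in I$, $r=1,\dots,n$. Let $x_1<\cdots<x_n$ be points of $I$ and $M=(f_c(x_r))_{r,c=1}^n$. Then for all $0<j\le i\le n$, \[ \frac{\det M[i-j+1,\dots,i\mid 1,\dots,j]}{V(a_1,\dots,a_j)\,V(x_{i-j+1},\dots,x_i)}=\sum_{\lambda}\frac{F_\lambda}{C_\lambda}\,s_\lambda(a_1,\dots,a_j)\,s_\lambda(x_{i-j+1},\dots,x_i), \] and \[ \frac{\det M^t[i-j+1,\dots,i\mid 1,\dots,j]}{V(a_{i-j+1},\dots,a_i)\,V(x_1,\dots,x_j)}=\sum_{\lambda}\frac{F_\lambda}{C_\lambda}\,s_\lambda(a_{i-j+1},\dots,a_i)\,s_\lambda(x_1,\dots,x_j), \] where the sums run over all integer partitions $\lambda$ (those with more than $j$ parts contribute $0$), and for $\lambda=(\lambda_1\ge\cdots\ge\lambda_j\ge0)$, \[ C_\lambda:=\lambda_j!\,(\lambda_{j-1}+1)!\cdots(\lambda_1+j-1)!,\qquad F_\lambda:=\prod_{l=1}^j f^{(\lambda_l+j-l)}(0). \]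
   Context: For a matrix $B$, $B[i_1,\dots,i_r\mid j_1,\dots,j_s]$ denotes the submatrix with rows $i_1,\dots,i_r$ and columns $j_1,\dots,j_s$; $B^t$ is the transpose. The Vandermonde determinant is $V(y_1,\dots,y_m):=\det(y_c^{m-r})_{r,c=1}^m$. For a partition $\lambda=(\lambda_1\ge\cdots\ge\lambda_m\ge0)$ with at most $m$ parts, the Schur polynomial is $s_\lambda(y_1,\dots,y_m):=\det(y_c^{\lambda_r+m-r})_{r,c=1}^m/V(y_1,\dots,y_m)$; $s_\lambda:=0$ if $\lambda$ has more than $m$ nonzero parts. *)

(* Defs.v *)
From HB Require Import structures.
From mathcomp Require Import all_boot all_order all_algebra.
From mathcomp Require Import finmap.
From mathcomp Require Import all_classical all_reals all_analysis.
From mathcomp.analysis.showcase Require Import summability.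

Set Implicit Arguments.
Unset Strict Implicit.
Unset Printing Implicit Defensive.

Import Order.TTheory GRing.Theory Num.Theory.
Import numFieldNormedType.Exports.

Local Open Scope classical_set_scope.
Local Open Scope ring_scope.

Definition is_partition (s : seq nat) : bool := sorted geq s && (0%N \notin s).

Notation partition_t := {s : seq nat | is_partition s}.

(* [part lam l] is the 0-based part $\lambda_{l+1}$, equal to 0 past the last
   positive part. *)
Definition part (lam : partition_t) (l : nat) : nat := nth 0%N (val lam) l.
Definition nparts (lam : partition_t) : nat := size (val lam).

(* Exponents decrease down the rows, so this determinant differs by the sign
   $(-1)^{m(m-1)/2}$ from that of the library matrix [Vandermonde]. With 0-based
   rows, the exponent $m - r$ is [m - r.+1]. *)
Definition vandermonde_det (F : comNzRingType) (m : nat) (y : 'I_m -> F) : F :=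
  \det (\matrix_(r < m, c < m) y c ^+ (m - r.+1)).

(* The value of the Schur polynomial as a bialternant quotient. It is meaningful
   only when the [y c] are pairwise distinct: otherwise the denominator is 0,
   and so is the quotient. *)
Definition schur (F : fieldType) (m : nat) (lam : partition_t)
    (y : 'I_m -> F) : F :=
  if (nparts lam <= m)%N then
    \det (\matrix_(r < m, c < m) y c ^+ (part lam r + (m - r.+1)))
      / vandermonde_det y
  else 0.

Fact window_subproof (n i j : nat) (k : 'I_j) :
  (j <= i)%N -> (i <= n)%N -> (i - j + k < n)%N.
Proof.
move=> hji hin; apply: leq_trans hin.
by rewrite -[ltnRHS](subnK hji) ltn_add2l.
Qed.

(* The indices $i-j+1, \dots, i$ (1-based) of $\{1, \dots, n\}$. *)
Definition window (n i j : nat) (hji : (j <= i)%N) (hin : (i <= n)%N)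
    (k : 'I_j) : 'I_n :=
  Ordinal (window_subproof k hji hin).

Section Analytic.
Variable R : realType.
Implicit Types (f : R -> R) (lam : partition_t).

(* [derive1n] is total, so differentiability is required on a neighborhood of 0
   (depending on [k]) for each iterated derivative to be a genuine one. *)
Definition smooth_at0 f : Prop :=
  forall k : nat, \forall t \near (0 : R), derivable f^`(k)%classic t 1.

Definition maclaurin f (k : nat) : R := f^`(k)%classic 0 / k`!%:R.

Definition radius_of_convergence (c : nat -> R) : \bar R :=
  ereal_sup [set `|t|%:E | t in [set t : R | cvgn (pseries c t)]].

Definition dilates (n : nat) f (a : 'I_n -> R) (r : 'I_n) : R -> R :=
  fun t => f (a r * t).

Definition collocation_mx (n : nat) (u : 'I_n -> R -> R) (x : 'I_n -> R) :
    'M[R]_n :=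
  \matrix_(r, c) u c (x r).

(* For $1 \le l \le j$, the shifted part $\lambda_l + j - l$ reads
   [part lam l + (j - l.+1)] with 0-based [l]. *)
Definition Ccoef (j : nat) lam : nat :=
  (\prod_(l < j) (part lam l + (j - l.+1))`!)%N.

Definition Fcoef f (j : nat) lam : R :=
  \prod_(l < j) f^`(part lam l + (j - l.+1))%classic 0.

Definition schur_term f (j : nat) (y z : 'I_j -> R) lam : R :=
  Fcoef f j lam / (Ccoef j lam)%:R * schur lam y * schur lam z.

(* Sum of a family over a countable index set with no preferred order: the net
   of partial sums over finite subsets converges (unconditionally) to [s]. *)
Definition has_sum (I : choiceType) (u : I -> R) (s : R) : Prop :=
  partial_sum u @ totally --> s.

End Analytic.

(* Main.v *)
(* Truncating the Maclaurin series f(t) = sum_k c_k t^k at order N turns the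
   minor of (f (a_r x_s)) into the determinant of a product of a j x N and an
   N x j matrix.  Cauchy-Binet expands it over the strictly decreasing exponent
   sequences k_1 > ... > k_j below N; these are the sequences
   lambda_l + j - l, and the two minors in each term are the numerators of the
   Schur polynomials.  Letting N tend to infinity gives the sum along an
   exhaustion of the partitions; it is unconditional because, bounding the
   minors by j! times a product of powers, the sum of the absolute values is at
   most a constant times (sum_k |c_k| T^k)^j for some T < R. *)
Require Import Defs.
From mathcomp Require Import all_boot all_order all_algebra.
From mathcomp Require Import finmap perm zify.
From mathcomp Require Import all_classical all_reals all_analysis.
From mathcomp.analysis.showcase Require Import summability.

Import Order.TTheory GRing.Theory Num.Theory.
Import numFieldNormedType.Exports.

Local Open Scope ring_scope.

(** * Strictly decreasing index sequences *)

Definition decreasing_ffun {m N : nat} (k : {ffun 'I_m -> 'I_N}) : bool :=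
  [forall r : 'I_m, forall s : 'I_m, (r < s)%N ==> (k s < k r)%N].

Lemma decreasing_ffunP {m N : nat} (k : {ffun 'I_m -> 'I_N}) :
  reflect (forall r s : 'I_m, (r < s)%N -> (k s < k r)%N) (decreasing_ffun k).
Proof.
apply: (iffP forallP) => [H r s rs|H r].
  by move/forallP/(_ s)/implyP: (H r); apply.
by apply/forallP => s; apply/implyP; apply: H.
Qed.

Lemma decreasing_ffun_lt {m N : nat} (k : {ffun 'I_m -> 'I_N}) (r s : 'I_m) :
  decreasing_ffun k -> (k r < k s)%N = (s < r)%N.
Proof.
move/decreasing_ffunP => dk; case: (ltngtP s r) => [/dk//|/dk/ltnW|/val_inj->].
  by rewrite leqNgt => /negbTE.
by rewrite ltnn.
Qed.

Lemma decreasing_ffun_inj {m N : nat} (k : {ffun 'I_m -> 'I_N}) :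
  decreasing_ffun k -> injective k.
Proof.
move=> dk r s krs; apply/val_inj.
by case: (ltngtP r s) => // /(decreasing_ffunP _ dk); rewrite krs ltnn.
Qed.

(** * Sorting permutations and the Cauchy-Binet formula *)

Section Ranking.
Variables (m N : nat).
Implicit Types (k : {ffun 'I_m -> 'I_N}) (s : 'S_m).

(* [insubd l] only supplies a default: the cardinal is always below [m]. *)
Definition ranking k : {ffun 'I_m -> 'I_m} :=
  [ffun l => insubd l #|[set q | (k l < k q)%N]|].

Lemma rankingE k l : ranking k l = #|[set q | (k l < k q)%N]| :> nat.
Proof.
have lm : (#|[set q | (k l < k q)%N]| < m)%N.
  rewrite -[ltnRHS]card_ord -cardsT; apply: proper_card; rewrite properT.
  by apply/eqP => /setP/(_ l); rewrite !inE ltnn.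
by rewrite ffunE val_insubd lm.
Qed.

Lemma ranking_lt k p q : (k p < k q)%N -> (ranking k q < ranking k p)%N.
Proof.
move=> pq; rewrite !rankingE; apply: proper_card; apply/properP; split.
  by apply/fintype.subsetP => l; rewrite !inE; apply: ltn_trans.
by exists q; rewrite !inE ?ltnn.
Qed.

Lemma ranking_inj k : injective k -> injective (ranking k).
Proof.
move=> ik p q e; apply/ik/val_inj.
by case: (ltngtP (k p) (k q)) => // /ranking_lt; rewrite e ltnn.
Qed.

(** The identity is only a default: for injective [k] the ranking is injective, hence a
    permutation. *)
Definition ranking_perm k : 'S_m := insubd (1%g : {perm 'I_m}) (ranking k).

Lemma ranking_permE k l : injective k -> ranking_perm k l = ranking k l.
Proof.
by move=> ik; rewrite -pvalE val_insubd; have /injectiveP-> := ranking_inj k ik.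
Qed.

(** Since [k] decreases, the entries of the composite exceeding the one at [l] are those at [q] with
    [s q < s l], and there are exactly [s l] of them. *)
Lemma ranking_perm_comp k s :
  decreasing_ffun k -> ranking_perm [ffun l => k (s l)] = s.
Proof.
move=> dk; have ik := decreasing_ffun_inj k dk.
have iks : injective [ffun l => k (s l)].
  by move=> p q; rewrite !ffunE => /ik/perm_inj.
apply/permP => l; rewrite ranking_permE //; apply: val_inj; rewrite /= rankingE.
rewrite -(card_imset _ (@perm_inj _ s)).
transitivity #|[set q : 'I_m | (q < s l)%N]|.
  apply: eq_card => q; rewrite inE; apply/imsetP/idP => [[p]|qs].
    by rewrite inE !ffunE decreasing_ffun_lt // => ? ->.
  by exists (s^-1 q)%g; rewrite ?permKV // inE !ffunE permKV decreasing_ffun_lt.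
rewrite cardsE -sum1_card (big_ord_narrow (ltnW (ltn_ord (s l)))).
by rewrite sum1_card card_ord.
Qed.

(* Every injective sequence is uniquely a decreasing one composed with a
   permutation, namely its ranking. *)
Lemma big_injective_ffun (V : nmodType) (F : {ffun 'I_m -> 'I_N} -> V) :
  \sum_(k : {ffun 'I_m -> 'I_N} | injectiveb k) F k =
  \sum_(k : {ffun 'I_m -> 'I_N} | decreasing_ffun k)
    \sum_(s : 'S_m) F [ffun l => k (s l)].
Proof.
rewrite pair_big /=.
rewrite (reindex_onto
  (fun ks : {ffun 'I_m -> 'I_N} * 'S_m => [ffun l => ks.1 (ks.2 l)])
  (fun k => ([ffun l => k ((ranking_perm k)^-1 l)%g], ranking_perm k))) /=.
  apply: eq_bigl => -[k s] /=; rewrite andbT.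
  apply/andP/idP => [[/injectiveP i /eqP[]]|dk].
    move=> <- _; apply/decreasing_ffunP => p q pq; rewrite !ffunE.
    set k' := [ffun _ => _] in i *.
    (* If the order of two values were not reversed, either injectivity or the ranking would
       contradict [p < q]. *)
    rewrite ltnNge leq_eqVlt; apply/negP => /orP[/eqP/val_inj|].
      rewrite -![k (s _)](ffunE (fun l => k (s l))) => /i/perm_inj e.
      by move: pq; rewrite e ltnn.
    rewrite -![k (s _)](ffunE (fun l => k (s l))) => /ranking_lt.
    by rewrite -!ranking_permE // !permKV ltnNge ltnW.
  split.
    by apply/injectiveP => p q; rewrite !ffunE => /(decreasing_ffun_inj k dk)/perm_inj.
  rewrite ranking_perm_comp //; apply/eqP; congr pair.
  by apply/ffunP => l; rewrite !ffunE permKV.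
by move=> k _; apply/ffunP => l; rewrite !ffunE permK.
Qed.

(** Expanding each row of the product gives a sum over all index sequences [k]. A repeated index
    gives two equal rows and hence a zero minor of [B]. The injective sequences are grouped by their
    decreasing rearrangement, and the signs from reordering the rows of [B] assemble the minor of
    [A]. *)
Lemma cauchy_binet (F : comPzRingType) (A : 'M[F]_(m, N)) (B : 'M[F]_(N, m)) :
  \det (A *m B) =
  \sum_(k : {ffun 'I_m -> 'I_N} | decreasing_ffun k)
    \det (colsub k A) * \det (rowsub k B).
Proof.
transitivity (\sum_(k : {ffun 'I_m -> 'I_N})
    (\prod_r A r (k r)) * \det (rowsub k B)).
  under [RHS]eq_bigr do rewrite mulr_sumr.
  rewrite exchange_big; apply: eq_bigr => s _.
  under eq_bigr do rewrite mxE; rewrite bigA_distr_bigA mulr_sumr.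
  apply: eq_bigr => k _; rewrite mulrCA -big_split.
  by congr (_ * _); apply: eq_bigr => r _; rewrite mxE.
rewrite (bigID (fun k : {ffun _} => injectiveb k)) /=.
rewrite [X in _ + X]big1 ?addr0 => [|k].
  rewrite big_injective_ffun; apply: eq_bigr => k _.
  rewrite mulr_suml; apply: eq_bigr => s _.
  have -> : rowsub [ffun l => k (s l)] B = row_perm s (rowsub k B).
    by apply/matrixP => p q; rewrite !mxE ffunE.
  rewrite row_permE det_mulmx det_perm mulrA; congr (_ * _).
  by rewrite mulrC; congr (_ * _); apply: eq_bigr => r _; rewrite mxE ffunE.
move/injectivePn => [p [q pq kpq]].
by rewrite (determinant_alternate pq) ?mulr0 // => l; rewrite !mxE kpq.
Qed.

End Ranking.

(** * Partitions and their parts *)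

(** The zeros of a nonincreasing list are at its end, where the default value of [nth] replaces
    them. *)
Lemma nth_filter_pos (s : seq nat) (l : nat) : sorted geq s ->
  nth 0%N [seq x <- s | x != 0%N] l = nth 0%N s l.
Proof.
elim: s l => [//|x s IHs] l xs.
have [x0|xn0] /= := eqVneq x 0%N; last first.
  by rewrite xn0; case: l => //= l; apply: IHs; apply: path_sorted xs.
have s0 : all (pred1 0%N) (x :: s).
  rewrite /= x0 eqxx.
  apply: sub_all (order_path_min (rev_trans leq_trans) xs) => y /=.
  by rewrite x0 leqn0.
move: (s0); rewrite /= => /andP[_ /all_pred1P s_nseq].
rewrite x0 /= IHs ?(path_sorted xs) // s_nseq nth_nseq.
by rewrite -[0%N :: _]/(nseq (size s).+1 0%N) nth_nseq !if_same.
Qed.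

(** Stored parts are positive, so the length is the first index at which [part] vanishes. *)
Lemma partition_eq (lam mu : partition_t) : part lam =1 part mu -> lam = mu.
Proof.
have part0 (nu : partition_t) l : (part nu l == 0%N) = (nparts nu <= l)%N.
  have [ge|lt] := leqP (nparts nu) l; first by rewrite /part nth_default.
  have /andP[_ /negP nu0] := valP nu.
  by apply/negbTE/eqP => e; apply: nu0; rewrite -e mem_nth.
move=> e; apply/val_inj/(@eq_from_nth _ 0%N) => [|l _]; last exact: e.
apply/eqP; rewrite eqn_leq; change (nparts lam <= nparts mu <= nparts lam)%N.
by rewrite -!part0 e part0 leqnn -e part0 leqnn.
Qed.

Lemma part_nonincreasing (lam : partition_t) p q :
  (p <= q)%N -> (part lam q <= part lam p)%N.
Proof.
move=> pq; have /andP[slam _] := valP lam.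
have [ge|lt] := leqP (nparts lam) q; first by rewrite /part nth_default.
apply: (sorted_leq_nth (rev_trans leq_trans) leqnn) => //; rewrite inE //.
exact: leq_ltn_trans lt.
Qed.

Definition shifted_part (j : nat) (lam : partition_t) (l : nat) : nat :=
  (part lam l + (j - l.+1))%N.

(** * Correspondence between decreasing sequences and partitions *)

Section DecreasingPartitions.
Variables (j N : nat).
Implicit Types (k : {ffun 'I_j -> 'I_N}) (lam : partition_t).

Definition unshifted k : seq nat := [seq (k l - (j - l.+1))%N | l : 'I_j].

(** Each step to the right lowers the value by at least one. *)
Lemma decreasing_ffun_gap k (p q : 'I_j) :
  decreasing_ffun k -> (p <= q)%N -> (k q + (q - p) <= k p)%N.
Proof.
move/decreasing_ffunP => dk.
suff H d (r : 'I_j) : (p + d = r)%N -> (k r + d <= k p)%N.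
  by move=> /subnKC; apply: H.
elim: d r => [r|d IHd r rE]; first by rewrite !addn0 => /val_inj ->.
have pdj : (p + d < j)%N by apply: leq_trans (ltn_ord r); rewrite -rE addnS.
apply: leq_trans (IHd (Ordinal pdj) erefl).
by rewrite addnS -addSn leq_add2r; apply: dk; rewrite /= -rE addnS.
Qed.

(** This is the gap down to the last index [j - 1]; it makes the subtraction in [unshifted] a
    genuine one. *)
Lemma decreasing_ffun_ge k (l : 'I_j) : decreasing_ffun k -> (j - l.+1 <= k l)%N.
Proof.
move=> dk; have j0 : (j.-1 < j)%N by rewrite ltn_predL (leq_ltn_trans _ (ltn_ord l)).
have := decreasing_ffun_gap k l (Ordinal j0) dk; have := ltn_ord l => /=; lia.
Qed.

Lemma unshifted_sorted k : decreasing_ffun k -> sorted geq (unshifted k).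
Proof.
move=> dk; rewrite /unshifted /image_mem sorted_map.
have sj : sorted (relpre val ltn) (enum 'I_j).
  by rewrite -sorted_map val_enum_ord iota_ltn_sorted.
apply: sub_sorted sj => p q /= pq.
have := decreasing_ffun_gap k p q dk (ltnW pq).
have := decreasing_ffun_ge k q dk; have := ltn_ord q; lia.
Qed.

(** Zeros are dropped because a partition stores only positive parts; the empty partition is the
    default when [k] is not decreasing. *)
Definition of_decreasing k : partition_t :=
  insubd (exist _ [::] isT) [seq x <- unshifted k | x != 0%N].

Lemma val_of_decreasing k : decreasing_ffun k ->
  val (of_decreasing k) = [seq x <- unshifted k | x != 0%N].
Proof.
move=> dk; rewrite val_insubd /is_partition sorted_filter ?unshifted_sorted //.
  by rewrite mem_filter.
exact: rev_trans leq_trans.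
Qed.

Lemma nparts_of_decreasing k :
  decreasing_ffun k -> (nparts (of_decreasing k) <= j)%N.
Proof.
move=> dk; rewrite /nparts val_of_decreasing // size_filter.
by apply: leq_trans (count_size _ _) _; rewrite size_map size_enum_ord.
Qed.

Lemma of_decreasingK k (l : 'I_j) : decreasing_ffun k ->
  shifted_part j (of_decreasing k) l = k l.
Proof.
move=> dk; rewrite /shifted_part /part val_of_decreasing //.
rewrite nth_filter_pos ?unshifted_sorted //.
rewrite (nth_map l) ?size_enum_ord // nth_ord_enum.
by rewrite subnK // decreasing_ffun_ge.
Qed.

Lemma of_decreasing_inj : {in decreasing_ffun &, injective of_decreasing}.
Proof.
move=> k k' dk dk' e; apply/ffunP => l; apply: val_inj.
by rewrite /= -!of_decreasingK // e.
Qed.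

(** Taking an image makes finiteness immediate and lets sums be reindexed by decreasing
    sequences. *)
Definition bounded_partitions : {fset partition_t} :=
  [fset of_decreasing k | k in enum decreasing_ffun]%fset.

Lemma mem_bounded_partitions lam : (lam \in bounded_partitions) =
  (nparts lam <= j)%N && [forall l : 'I_j, shifted_part j lam l < N]%N.
Proof.
apply/imfsetP/andP => [[k /=]|[lamj /forallP lamN]].
  rewrite mem_enum => dk ->; split; first exact: nparts_of_decreasing.
  by apply/forallP => l; rewrite of_decreasingK.
pose k := [ffun l : 'I_j => Ordinal (lamN l)].
have dk : decreasing_ffun k.
  apply/decreasing_ffunP => p q pq; rewrite !ffunE /=.
  have := part_nonincreasing lam p q (ltnW pq); have := ltn_ord q.
  rewrite /shifted_part; lia.
exists k; [by rewrite mem_enum|apply: partition_eq => l].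
(* From index [j] on, both partitions have only zero parts. *)
have [jl|lj] := leqP j l.
  rewrite /part !nth_default // ?(leq_trans lamj) //.
  by rewrite (leq_trans (nparts_of_decreasing _ _)).
have := of_decreasingK k (Ordinal lj) dk; rewrite ffunE /= /shifted_part.
by move/addIn.
Qed.

Lemma big_bounded_partitions (V : nmodType) (F : partition_t -> V) :
  \sum_(lam <- bounded_partitions) F lam =
  \sum_(k : {ffun 'I_j -> 'I_N} | decreasing_ffun k) F (of_decreasing k).
Proof.
rewrite big_imfset /= => [|k k']; first by rewrite undup_id ?enum_uniq // big_enum.
by rewrite !mem_enum; apply: of_decreasing_inj.
Qed.

End DecreasingPartitions.

Local Open Scope classical_set_scope.
Local Open Scope ring_scope.

(** * Unconditional sums from an exhaustion *)

Section HasSum.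
Variables (R : realType) (I : choiceType).
Implicit Types (A B : {fset I}) (u : I -> R).

Lemma ler_sum_fset A B u : (forall i, 0 <= u i) -> (A `<=` B)%fset ->
  \sum_(i <- A) u i <= \sum_(i <- B) u i.
Proof.
move=> u0 AB; rewrite [leRHS](big_fsetID _ (mem A)) /=.
have -> : [fset x in B | x \in A]%fset = A.
  apply/fsetP => x; rewrite !inE /=.
  by case: (boolP (x \in A)) => [/(fsubsetP AB)->|]; rewrite ?andbF.
by rewrite lerDl sumr_ge0.
Qed.

(** Once [G N] carries almost all of the absolute mass, any finite [A] containing it changes the
    partial sum by at most the remaining mass. The sets need only exhaust the support of [u]. *)
Lemma has_sum_exhaustion u (G : nat -> {fset I}) (s M : R) :
    {homo G : N N' / (N <= N')%N >-> (N `<=` N')%fset} ->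
    (forall i, u i != 0 -> exists N, i \in G N) ->
    (forall N, \sum_(i <- G N) `|u i| <= M) ->
    (\sum_(i <- G N) u i) @[N --> \oo] --> s ->
  has_sum u s.
Proof.
move=> Gmono Gfull bounded cvgs.
pose T N := \sum_(i <- G N) `|u i|.
have Tmono : {homo T : N N' / (N <= N')%N >-> N <= N'}.
  by move=> N N' /Gmono ?; apply: ler_sum_fset.
have cvgT : cvgn T.
  by apply: nondecreasing_is_cvgn => //; exists M => _ [N _ <-]; apply: bounded.
have T_lim N : T N <= limn T by apply: nondecreasing_cvgn_le.
have tF := @totally_filter I.
apply/cvgrPdist_lt => e e0.
have e20 : 0 < e / 2 by rewrite divr_gt0.
have [N [sN TN]] : exists N, `|s - \sum_(i <- G N) u i| < e / 2 /\
    `|limn T - T N| < e / 2.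
  have /cvgrPdist_lt/(_ _ e20) P := cvgs.
  have /cvgrPdist_lt/(_ _ e20) Q := cvgT.
  have [N _ NPQ] : \forall N \near \oo, `|s - \sum_(i <- G N) u i| < e / 2 /\
    `|limn T - T N| < e / 2 by near=> N; split; near: N.
  by exists N; apply: NPQ => /=.
exists (G N) => //= A GNA.
(* The finitely many indices of [A] in the support all lie in one [G N'], with [N'] the largest of
   their chosen stages. *)
have absA : \sum_(i <- A) `|u i| <= limn T.
  have [n nP] : {n : I -> nat & forall i, u i != 0 -> i \in G (n i)}.
    by apply: (@choice _ _ (fun i N => u i != 0 -> i \in G N)) => i;
      case: (pselect (u i != 0)) => [/Gfull[N' ?]|?]; [exists N'|exists 0%N].
  pose N' := (\max_(i <- A) n i)%N.
  apply: le_trans (T_lim N').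
  rewrite (big_fsetID _ (fun i => u i != 0)) /= [X in _ + X]big1_seq ?addr0.
    apply: ler_sum_fset => //; apply/fsubsetP => i; rewrite !inE /= => /andP[iA /nP].
    by apply/fsubsetP/Gmono/leq_bigmax_seq.
  by move=> i; rewrite !inE /= => /andP[_ /negPn/eqP->]; rewrite normr0.
have split_sum (v : I -> R) : \sum_(i <- A) v i =
    \sum_(i <- G N) v i + \sum_(i <- (A `\` G N)%fset) v i.
  rewrite (big_fsetID _ (mem (G N))) /=; congr (_ + _); apply: eq_fbigl => i.
    rewrite !inE /=.
    by case: (boolP (i \in G N)) => [/(fsubsetP GNA)->|]; rewrite ?andbF.
  by rewrite !inE /= andbC.
rewrite /partial_sum -(big_seq_fsetE _ _ xpredT) split_sum opprD addrA.
rewrite (splitr e); apply: le_lt_trans (ler_normB _ _) _; apply: ltrD => //.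
apply: le_lt_trans (ler_norm_sum _ _ _) _; apply: le_lt_trans TN.
apply: le_trans (ler_norm _); rewrite lerBrDl.
by rewrite -split_sum.
Unshelve. all: by end_near. Qed.

End HasSum.

(** * Bounds and limits of determinants *)

Lemma ler_norm_det (F : numDomainType) (m : nat) (A : 'M[F]_m) (b : 'I_m -> F) :
  (forall r s, `|A r s| <= b r) -> `|\det A| <= m`!%:R * \prod_r b r.
Proof.
move=> Ab; apply: le_trans (ler_norm_sum _ _ _) _.
rewrite -card_Sn mulr_natl -sumr_const; apply: ler_sum => s _.
rewrite normrM normrX normrN1 expr1n mul1r normr_prod.
by apply: ler_prod => r _; rewrite normr_ge0 Ab.
Qed.

Lemma cvg_det (F : numFieldType) (T : Type) (G : set_system T) (FG : Filter G)
    (m : nat) (A : T -> 'M[F]_m) (B : 'M[F]_m) :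
  (forall r s, A t r s @[t --> G] --> B r s) -> \det (A t) @[t --> G] --> \det B.
Proof.
move=> AB; rewrite /determinant.
apply: cvg_big => [|s _]; first exact: add_continuous.
apply: cvgM; first exact: cvg_cst.
by apply: cvg_big => [|r _]; [exact: mul_continuous|exact: AB].
Qed.

(** * Expansion of the determinant into Schur terms *)

Section Expansion.
Variables (R : realType) (f : R -> R) (j : nat).
Implicit Types (y z : 'I_j -> R) (lam : partition_t).

(** For [e] the shifted parts of a partition, this is the numerator of its Schur polynomial. *)
Definition alternant y (e : 'I_j -> nat) : R := \det (\matrix_(r, s) y s ^+ e r).

Lemma schur_termE y z lam : (nparts lam <= j)%N ->
  schur_term f y z lam =
    \prod_(l < j) maclaurin f (shifted_part j lam l) *
    (alternant y (shifted_part j lam) * alternant z (shifted_part j lam)) /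
    (vandermonde_det y * vandermonde_det z).
Proof.
move=> lamj; rewrite /schur_term /schur lamj.
have -> : Fcoef f j lam / (Ccoef j lam)%:R =
    \prod_(l < j) maclaurin f (shifted_part j lam l).
  by rewrite /Fcoef /Ccoef natr_prod -prodf_div.
by rewrite -!mulrA; congr (_ * (_ * _)); rewrite invfM mulrCA.
Qed.

Lemma det_partial_sums (c : nat -> R) y z (N : nat) :
  \det (\matrix_(r, s) pseries c (y r * z s) N) =
  \sum_(k : {ffun 'I_j -> 'I_N} | decreasing_ffun k)
    \prod_l c (k l) * (alternant y (val \o k) * alternant z (val \o k)).
Proof.
pose A : 'M[R]_(j, N) := \matrix_(r, k) (c k * y r ^+ k).
pose B : 'M[R]_(N, j) := \matrix_(k, s) (z s ^+ k).
transitivity (\det (A *m B)).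
  congr (\det _); apply/matrixP => r s; rewrite !mxE /pseries /series /= big_mkord.
  by apply: eq_bigr => k _; rewrite !mxE exprMn mulrA.
rewrite cauchy_binet; apply: eq_bigr => k _; rewrite mulrA; congr (_ * _).
  (* Each coefficient [c (k l)] factors out of its column as a diagonal entry. *)
  have -> : \prod_l c (k l) = \det (diag_mx (\row_l c (k l))).
    by rewrite det_diag; apply: eq_bigr => l _; rewrite mxE.
  rewrite mulrC -[alternant _ _]det_tr -det_mulmx.
  by congr (\det _); apply/matrixP => r s; rewrite mul_mx_diag !mxE mulrC.
by congr (\det _); apply/matrixP => r s; rewrite !mxE.
Qed.

Lemma ler_norm_alternant y (alpha : R) (e : 'I_j -> nat) :
  (forall r, `|y r| <= alpha) -> `|alternant y e| <= j`!%:R * \prod_l alpha ^+ e l.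
Proof.
move=> y_le; apply: ler_norm_det => r s; rewrite mxE normrX.
by apply: lerXn2r; rewrite ?nnegrE ?(le_trans _ (y_le s)).
Qed.

Lemma has_sum_schur_term y z (alpha beta : R) :
    (forall r, `|y r| <= alpha) -> (forall r, `|z r| <= beta) ->
    cvgn (pseries (fun k => `|maclaurin f k|) (alpha * beta)) ->
    (forall r s, pseries (maclaurin f) (y r * z s) @ \oo --> f (y r * z s)) ->
  has_sum (schur_term f y z)
    (\det (\matrix_(r, s) f (y r * z s)) / (vandermonde_det y * vandermonde_det z)).
Proof.
move=> y_le z_le abs_cvg f_sum.
set V := vandermonde_det y * _.
pose c := maclaurin f.
have termE N (k : {ffun 'I_j -> 'I_N}) : decreasing_ffun k ->
    schur_term f y z (of_decreasing j N k) =
    \prod_l c (k l) * (alternant y (val \o k) * alternant z (val \o k)) / V.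
  move=> dk; rewrite schur_termE ?nparts_of_decreasing //.
  have eqk l : shifted_part j (of_decreasing j N k) (nat_of_ord l) = k l.
    exact: of_decreasingK.
  congr (_ * (_ * _) / _); first by apply: eq_bigr => l _; rewrite eqk.
  - by congr (\det _); apply/matrixP => r s; rewrite !mxE eqk.
  - by congr (\det _); apply/matrixP => r s; rewrite !mxE eqk.
pose b k := `|c k| * (alpha * beta) ^+ k.
pose S := limn (pseries (fun k => `|c k|) (alpha * beta)).
(* Each of the two alternants contributes one factor [j!]. *)
pose K : R := j`!%:R ^+ 2 / `|V|.
apply: (@has_sum_exhaustion _ _ _ (bounded_partitions j) _ (K * S ^+ j)).
- move=> N N' NN'; apply/fsubsetP => lam; rewrite !mem_bounded_partitions.
  move=> /andP[-> /forallP lamN]; apply/forallP => l; exact: leq_trans NN'.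
- move=> lam u0; have lamj : (nparts lam <= j)%N.
    by apply: contraNT u0; rewrite /schur_term /schur => /negbTE->; rewrite mulr0.
  (* The successor makes the bound on the shifted parts strict. *)
  exists (\max_(l < j) (shifted_part j lam l).+1)%N.
  rewrite mem_bounded_partitions lamj /=; apply/forallP => l.
  exact: (@bigop.leq_bigmax _ (fun l : 'I_j => (shifted_part j lam l).+1) l).
- move=> N; rewrite big_bounded_partitions.
  (* An index [l] is taken as argument because [alpha] and [beta] are known to be nonnegative only
     through some [y l] and [z l]. *)
  have b_ge0 (l : 'I_j) k : 0 <= b k.
    have alpha_ge0 : 0 <= alpha by apply: le_trans (y_le l).
    have beta_ge0 : 0 <= beta by apply: le_trans (z_le l).
    by rewrite mulr_ge0 ?exprn_ge0 ?mulr_ge0.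
  have b_sum (l : 'I_j) : \sum_(k < N) b k <= S.
    rewrite -(big_mkord xpredT b).
    apply: (nondecreasing_cvgn_le _ abs_cvg N).
    by apply: nondecreasing_series => k _ _; apply: b_ge0 l _.
  apply: (@le_trans _ _ (\sum_(k : {ffun 'I_j -> 'I_N} | decreasing_ffun k)
      K * \prod_l b (k l))).
    apply: ler_sum => k dk; rewrite termE // !normrM normfV normr_prod.
    rewrite /K [leRHS]mulrAC; apply: ler_wpM2r; first by rewrite invr_ge0.
    apply: (@le_trans _ _ (\prod_l `|c (k l)| * ((j`!%:R * \prod_l alpha ^+ k l) *
        (j`!%:R * \prod_l beta ^+ k l)))).
      by rewrite ler_wpM2l ?prodr_ge0 // ler_pM // ler_norm_alternant.
    have -> : \prod_l b (k l) =
        \prod_l `|c (k l)| * (\prod_l alpha ^+ k l * \prod_l beta ^+ k l).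
      by rewrite -!big_split; apply: eq_bigr => l _; rewrite /b exprMn.
    by rewrite [X in _ * X <= _]mulrACA [leLHS]mulrCA expr2.
  rewrite -mulr_sumr; apply: ler_wpM2l; first by rewrite divr_ge0 ?exprn_ge0.
  (* Enlarging the sum to all sequences lets it factor as the [j]-th power of a single sum. *)
  apply: (@le_trans _ _ (\sum_(k : {ffun 'I_j -> 'I_N}) \prod_l b (k l))).
    rewrite [leRHS](bigID decreasing_ffun) /= lerDl; apply: sumr_ge0 => k _.
    by apply: prodr_ge0 => l _; apply: b_ge0 l _.
  rewrite -(bigA_distr_bigA (fun (_ : 'I_j) (k : 'I_N) => b k)).
  rewrite -[in leRHS](card_ord j) -prodr_const; apply: ler_prod => l _.
  by rewrite b_sum // sumr_ge0 // => k _; apply: b_ge0 l _.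
- under eq_fun do rewrite big_bounded_partitions (eq_bigr _ (termE _)) -mulr_suml
    -det_partial_sums.
  apply: cvgMr_tmp; apply: cvg_det => r s.
  by rewrite mxE; under eq_fun do rewrite mxE; apply: f_sum.
Qed.

End Expansion.

(** * Convergence inside the radius and the two determinant expansions *)

(** Convergence at the larger point [t'] yields absolute convergence at [t]. *)
Lemma lte_radius_between (R : realType) (rho : \bar R) (t : R) :
  (t%:E < rho)%E -> exists2 t', t < t' & (t'%:E < rho)%E.
Proof.
case: rho => [r|_|//]; last by exists (t + 1); rewrite ?ltrDl ?ltry.
by rewrite lte_fin => tr; exists ((t + r) / 2); rewrite ?lte_fin ?midf_lt.
Qed.

Theorem theorem4 (R : realType) (f : R -> R) (rho : \bar R)
    (f_smooth : smooth_at0 f)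
    (rho_gt0 : (0 < rho)%E)
    (rhoE : radius_of_convergence (maclaurin f) = rho)
    (f_sum : forall t : R, (- rho < t%:E < rho)%E ->
       pseries (maclaurin f) t @ \oo --> f t)
    (n : nat) (a x : 'I_n.+1 -> R)
    (a_gt0 : forall r : 'I_n.+1, 0 < a r)
    (a_incr : forall r s : 'I_n.+1, (r < s)%N -> a r < a s)
    (x_in : forall r : 'I_n.+1,
       (- (rho / (a ord_max)%:E) < (x r)%:E < rho / (a ord_max)%:E)%E)
    (x_incr : forall r s : 'I_n.+1, (r < s)%N -> x r < x s)
    (i j : nat) (hj : (0 < j)%N) (hji : (j <= i)%N) (hin : (i <= n.+1)%N) :
  let M := collocation_mx (dilates f a) x in
  let first := widen_ord (leq_trans hji hin) in
  let win := window hji hin in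
  has_sum (schur_term f (a \o first) (x \o win))
    (\det (mxsub win first M)
      / (vandermonde_det (a \o first) * vandermonde_det (x \o win)))
  /\
  has_sum (schur_term f (a \o win) (x \o first))
    (\det (mxsub win first M^T)
      / (vandermonde_det (a \o win) * vandermonde_det (x \o first))).
Proof.
set A := a ord_max in x_in; have A_gt0 : 0 < A := a_gt0 _.
have a_le r : `|a r| <= A.
  rewrite gtr0_norm // /A; have [->//|rmax] := eqVneq r ord_max.
  apply/ltW/a_incr; rewrite ltn_neqAle -ltnS ltn_ord andbT.
  by apply: contraNN rmax => /eqP rn; apply/eqP/val_inj.
have Ax_lt r : ((A * `|x r|)%:E < rho)%E.
  have := x_in r; case: (rho) rho_gt0 => [p _|_ _|//]; last by rewrite ltry.
  rewrite inver gt_eqF // -EFinM -EFinN !lte_fin -ltr_norml.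
  by rewrite ltr_pdivlMr // mulrC.
pose r0 := [arg max_(r > (ord0 : 'I_n.+1)) `|x r|]%O.
have x_le r : `|x r| <= `|x r0|.
  by rewrite /r0; case: arg_maxP => // q _ /(_ r); apply.
have f_cvg t : ((`|t|)%:E < rho)%E -> pseries (maclaurin f) t @ \oo --> f t.
  move=> t_lt; apply: f_sum; apply/andP; split.
    rewrite lteNl; apply: le_lt_trans t_lt.
    by rewrite -EFinN lee_fin ler_normr lexx orbT.
  by apply: le_lt_trans t_lt; rewrite lee_fin ler_norm.
have abs_cvg : cvgn (pseries (fun k => `|maclaurin f k|) (A * `|x r0|)).
  have [t' tt' t'rho] := lte_radius_between _ _ _ (Ax_lt r0).
  have t'0 : 0 <= t' by apply: le_trans (ltW tt'); rewrite mulr_ge0 // ltW.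
  apply: (@is_cvg_pseries_inside_norm _ _ t').
    by apply/cvg_ex; exists (f t'); apply: f_cvg; rewrite ger0_norm.
  by rewrite (ger0_norm t'0) ger0_norm // mulr_ge0 // ltW.
have ax_cvg r s : pseries (maclaurin f) (a r * x s) @ \oo --> f (a r * x s).
  by apply: f_cvg; apply: le_lt_trans (Ax_lt s); rewrite lee_fin normrM ler_wpM2r.
move=> M first win; split.
(* The rows of [M] are indexed by the points [x], so this minor is transposed to put the dilation
   factors [a] on the rows. *)
- have -> : \det (mxsub win first M) =
      \det (\matrix_(r, s) f (a (first r) * x (win s))).
    by rewrite -det_tr; congr (\det _); apply/matrixP => r s; rewrite !mxE.
  apply: (@has_sum_schur_term _ _ _ (a \o first) (x \o win) A `|x r0|)
    => // [r|r|r s]; [exact: a_le|exact: x_le|exact: ax_cvg].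
- have -> : \det (mxsub win first M^T) =
      \det (\matrix_(r, s) f (a (win r) * x (first s))).
    by congr (\det _); apply/matrixP => r s; rewrite !mxE.
  apply: (@has_sum_schur_term _ _ _ (a \o win) (x \o first) A `|x r0|)
    => // [r|r|r s]; [exact: a_le|exact: x_le|exact: ax_cvg].
Qed.
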